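(* There are no excessively hypercompact cardinals. In particular, there is no cardinal $\kappa$ such that $\kappa$ is excessively $(2^\kappa)^+$-hypercompact.
   Context: Work in ZFC. Excessive $\alpha$-hypercompactness is defined recursively. A cardinal $\kappa$ is excessively $0$-hypercompact iff $\kappa$ is supercompact. For an ordinal $\alpha>0$, a cardinal $\kappa$ is excessively $\alpha$-hypercompact iff for every cardinal $\delta\ge\kappa$ there is an elementary embedding $j:V\to M$ witnessing the $\delta$-supercompactness of $\kappa$ (i.e. $M$ is a transitive class, $j$ has critical point $\kappa$, $j(\kappa)>\delta$, and $M^\delta\subseteq M$), generated by a supercompact ultrafilter (a normal fine measure) on $P_\kappa(\delta)$, such that $M\models$ ''$\kappa$ is excessively $\beta$-hypercompact for every $\beta<\alpha$''. A cardinal $\kappa$ is excessively hypercompact iff it is excessively $\alpha$-hypercompact for every ordinal $\alpha$. *)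

(* Defs.v *)
Set Implicit Arguments.
Unset Strict Implicit.
Unset Printing Implicit Defensive.

Record set_structure : Type := SetStructure {
  carrier :> Type;
  mem : carrier -> carrier -> Prop
}.

Declare Scope set_scope.
Delimit Scope set_scope with set.
Notation "x 'in_' y" := (mem x y) (at level 70) : set_scope.
Local Open Scope set_scope.

(** * First-order formulas of the language of set theory *)

(** De Bruijn indices: [f_all] binds variable 0. *)
Inductive formula : Type :=
| f_mem (i j : nat)
| f_eq (i j : nat)
| f_bot
| f_imp (p q : formula)
| f_all (p : formula).

Definition scons (S : set_structure) (x : S) (e : nat -> S) : nat -> S :=
  fun n => match n with O => x | Datatypes.S m => e m end.

Fixpoint sat (S : set_structure) (e : nat -> S) (p : formula) : Prop :=
  match p with
  | f_mem i j => e i in_ e j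
  | f_eq i j => e i = e j
  | f_bot => False
  | f_imp p q => sat e p -> sat e q
  | f_all p => forall x : S, sat (scons x e) p
  end.

(** * Set-theoretic notions, interpreted in a structure *)

Section Notions.
Variable S : set_structure.
Implicit Types x y z a b f g p u v w : S.
Implicit Types P U X Y : S.

Definition subset x y := forall z, z in_ x -> z in_ y.
Definition is_empty x := forall z, ~ z in_ x.

Definition is_upair u x y := forall z, z in_ u <-> z = x \/ z = y.
Definition is_union u x := forall z, z in_ u <-> exists2 y, y in_ x & z in_ y.
Definition is_powerset u x := forall z, z in_ u <-> subset z x.

(** Kuratowski pairs. *)
Definition is_pair p x y :=
  exists a b, is_upair a x x /\ is_upair b x y /\ is_upair p a b.

Definition maps f x y := exists2 p, is_pair p x y & p in_ f.

Definition function_on f a :=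
  (forall p, p in_ f -> exists x y, x in_ a /\ is_pair p x y) /\
  (forall x, x in_ a -> exists! y, maps f x y).

Definition function f a b :=
  function_on f a /\ (forall x y, maps f x y -> y in_ b).

Definition bijection f a b :=
  function f a b /\ (forall y, y in_ b -> exists! x, maps f x y).

Definition equinumerous a b := exists f, bijection f a b.

(** Von Neumann ordinals, ordered by membership, and initial ordinals. *)
Definition transitive_set x := forall y, y in_ x -> subset y x.

Definition ordinal x :=
  transitive_set x /\ (forall y, y in_ x -> transitive_set y).

Definition cardinal x :=
  ordinal x /\ (forall y, y in_ x -> ~ equinumerous y x).

(** [c] is the cardinal [2 ^ k]. *)
Definition is_two_pow c k :=
  cardinal c /\ exists2 P, is_powerset P k & equinumerous P c.

(** [l] is the cardinal successor of [c]. *)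
Definition is_card_succ l c :=
  cardinal l /\ c in_ l /\ (forall m, cardinal m -> c in_ m -> subset l m).

(** [P] is the set of all subsets of [d] of cardinality less than [k]. *)
Definition is_Pk P k d :=
  forall x, x in_ P <->
    subset x d /\ exists2 g, g in_ k & equinumerous x g.

(** The subset of [P] cut out by [Q] belongs to [U]. *)
Definition large U P (Q : S -> Prop) :=
  exists2 X, X in_ U & forall x, x in_ X <-> x in_ P /\ Q x.

(** [U] is a [k]-complete, fine, normal ultrafilter on [P_k(d)]; normality is
    closure under diagonal intersections. *)
Definition normal_fine_measure U k d :=
  exists P, is_Pk P k d /\
    (forall X, X in_ U -> subset X P) /\
    P in_ U /\
    (forall X, X in_ U -> ~ is_empty X) /\
    (forall X Y, X in_ U -> subset X Y -> subset Y P -> Y in_ U) /\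
    (forall X, subset X P -> X in_ U \/ large U P (fun x => ~ x in_ X)) /\
    (forall g f, g in_ k -> function f g U ->
       large U P (fun x => forall i X, maps f i X -> x in_ X)) /\
    (forall i, i in_ d -> large U P (fun x => i in_ x)) /\
    (forall f, function f d U ->
       large U P (fun x => forall i X, i in_ x -> maps f i X -> x in_ X)).

(** Classes are definable with parameters, the parameters being supplied by
    the environment. *)
Definition definable_class (M : S -> Prop) :=
  exists (p : formula) (e : nat -> S), forall x, M x <-> sat (scons x e) p.

Definition transitive_class (M : S -> Prop) :=
  forall x y, M x -> y in_ x -> M y.

(** The structure [(M, in)]: set-theoretic notions interpreted in
    [inner M] are the corresponding notions relativized to [M]. *)
Definition inner (M : S -> Prop) : set_structure :=
  SetStructure (fun x y : sig M => proj1_sig x in_ proj1_sig y).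

End Notions.

(** * The axioms of ZFC *)

Section ZermeloFraenkel.
Variable S : set_structure.

Definition extensionality :=
  forall x y : S, (forall z, z in_ x <-> z in_ y) -> x = y.

Definition foundation :=
  forall x : S, ~ is_empty x -> exists2 y, y in_ x & forall z, z in_ y -> ~ z in_ x.

Definition pairing := forall x y : S, exists u, is_upair u x y.

Definition union := forall x : S, exists u, is_union u x.

Definition powerset := forall x : S, exists u, is_powerset u x.

Definition infinity :=
  exists w : S, (exists2 x, is_empty x & x in_ w) /\
    forall x, x in_ w ->
      exists2 y, y in_ w & forall z, z in_ y <-> z in_ x \/ z = x.

Definition separation :=
  forall (p : formula) (e : nat -> S) (x : S),
    exists y, forall z, z in_ y <-> z in_ x /\ sat (scons z e) p.

Definition replacement :=
  forall (p : formula) (e : nat -> S) (x : S),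
    (forall u, u in_ x -> exists! v, sat (scons u (scons v e)) p) ->
    exists y, forall v, v in_ y <-> exists2 u, u in_ x & sat (scons u (scons v e)) p.

Definition choice :=
  forall x : S,
    (forall y, y in_ x -> ~ is_empty y) ->
    (forall y z u, y in_ x -> z in_ x -> u in_ y -> u in_ z -> y = z) ->
    exists c : S, forall y, y in_ x -> exists! u, u in_ y /\ u in_ c.

Definition ZFC :=
  extensionality /\ foundation /\ pairing /\ union /\ powerset /\ infinity /\
  separation /\ replacement /\ choice.

End ZermeloFraenkel.

(** * Elementary embeddings and hypercompactness *)

Section Embeddings.
Variables (V : set_structure) (M : V -> Prop) (j : V -> inner M).

Definition definable_map :=
  exists (p : formula) (e : nat -> V),
    forall x y : V, proj1_sig (j x) = y <-> sat (scons x (scons y e)) p.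

Definition elementary :=
  forall (p : formula) (e : nat -> V),
    sat e p <-> sat (fun n => j (e n)) p.

(** [k] is the least ordinal moved by [j]. *)
Definition critical_point (k : V) :=
  ordinal k /\ proj1_sig (j k) <> k /\
  (forall a, a in_ k -> proj1_sig (j a) = a).

(** [M] contains every [d]-sequence of elements of [M]. *)
Definition closed_under_sequences (d : V) :=
  forall f, function_on f d -> (forall x y, maps f x y -> M y) -> M f.

Definition witnesses_supercompactness (k d : V) :=
  definable_class M /\ transitive_class M /\ definable_map /\ elementary /\
  critical_point k /\ d in_ proj1_sig (j k) /\ closed_under_sequences d.

(** [j : V -> M] is the canonical embedding into the ultrapower of [V] by [U],
    where [M] is the transitive collapse of the ultrapower and [cls f] is the
    element of [M] represented by the function [f] on [P_k(d)]. *)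
Definition generated_by (U k d : V) :=
  exists (P : V) (cls : V -> inner M), is_Pk P k d /\
    (forall f g, function_on f P -> function_on g P ->
       (cls f in_ cls g <->
        large U P (fun x => exists y z, maps f x y /\ maps g x z /\ y in_ z))) /\
    (forall f g, function_on f P -> function_on g P ->
       (cls f = cls g <->
        large U P (fun x => exists y, maps f x y /\ maps g x y))) /\
    (forall y : inner M, exists2 f, function_on f P & cls f = y) /\
    (forall a c, function_on c P -> (forall x, x in_ P -> maps c x a) ->
       cls c = j a).

End Embeddings.

Definition supercompact (V : set_structure) (k : V) : Prop :=
  cardinal k /\
  forall d : V, cardinal d -> subset k d ->
    exists (M : V -> Prop) (j : V -> inner M), witnesses_supercompactness j k d.

(** The recursion on [a] passes from a structure to its inner models, so the
    structure is an index of the predicate. The clauses determine the predicate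
    at every [a] in the well-founded part of [V], hence everywhere when [V] is
    well-founded; if [V] is ill-founded, the inductive predicate is the least
    solution of the clauses. *)
Inductive excessively_hypercompact_at :
  forall V : set_structure, V -> V -> Prop :=
| exc_hyp_zero (V : set_structure) (k a : V) :
    is_empty a -> supercompact k -> excessively_hypercompact_at k a
| exc_hyp_pos (V : set_structure) (k a : V) :
    ordinal a -> ~ is_empty a -> cardinal k ->
    (forall d : V, cardinal d -> subset k d ->
       exists (M : V -> Prop) (j : V -> inner M),
         witnesses_supercompactness j k d /\
         (exists U : V, normal_fine_measure U k d /\ generated_by j U k d) /\
         (forall b : V, b in_ a ->
            exists k' b' : inner M,
              proj1_sig k' = k /\ proj1_sig b' = b /\
              excessively_hypercompact_at k' b')) ->
    excessively_hypercompact_at k a.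

Definition excessively_hypercompact (V : set_structure) (k : V) : Prop :=
  cardinal k /\ forall a : V, ordinal a -> excessively_hypercompact_at k a.

(* Main.v *)
From Corelib Require Import ssreflect.
From Stdlib Require Import Classical PeanoNat Lia.
Require Import Defs.

Set Implicit Arguments.
Unset Strict Implicit.
Unset Printing Implicit Defensive.

Local Open Scope set_scope.

(** The theorem is proved by induction on the derivation of hypercompactness,
    in the following form: if [k] is excessively [a]-hypercompact in a model [V]
    of ZFC, then [a] injects into the power set of [k]
    ([hypercompact_degree_injects]). For the first claim, take for [a] an
    ordinal of the size of the double power set of [k]: an injection of [a]
    into the power set would contradict Cantor's theorem. For the second, an
    injection of [(2 ^ k)^+] into [2 ^ k] contradicts the
    Schroeder-Bernstein theorem.

    For the induction step, let [j : V -> M] witness [k]-supercompactness and be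
    generated by a normal fine measure on [P_k(k)].
    - In [V], the ordinal [j(k)] injects into the power set of [k]
      ([j_crit_injects_powerset]): its elements are the classes [cls f] of
      functions on [P_k(k)] with values in [k] almost everywhere, by normality
      almost every point of [P_k(k)] is an ordinal below [k], and so [cls f] is
      determined by a subset of [k * k], a set that injects into [k]
      ([square_injects]).
    - Hence, if [a] did not inject into the power set of [k], then [j(k)] would
      be an element of [a]. As [M] is a model of ZFC in which [k] is
      excessively [j(k)]-hypercompact, the induction hypothesis gives, in [M],
      an injection of [j(k)] into the power set of [k].
    - But [k] injects into the power set of no [m] in [k]
      ([not_injects_fixed]), so by elementarity [j(k)] injects in [M] into the
      power set of no [m] in [j(k)], and [k] is in [j(k)].

    Taking [j(k)] itself for the degree in [M] avoids computing [(2 ^ k)^+] in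
    [M].

    All the sets needed come from the axioms of [V], whose schemas speak of
    formulas. [expressible] and the tactic [express] show that a predicate is
    given by a formula by following its syntax. The other tool from set theory
    is [ex_enumeration]: any set is in bijection with an ordinal, the next
    element being picked according to a prescribed rule. *)

(** * Predicates given by formulas *)

Fixpoint rename (r : nat -> nat) (p : formula) : formula :=
  match p with
  | f_mem m n => f_mem (r m) (r n)
  | f_eq m n => f_eq (r m) (r n)
  | f_bot => f_bot
  | f_imp p q => f_imp (rename r p) (rename r q)
  | f_all p =>
      f_all (rename (fun n => match n with O => O | S m => S (r m) end) p)
  end.

Lemma sat_ext (V : set_structure) (p : formula) (e e' : nat -> V) :
  (forall n, e n = e' n) -> sat e p <-> sat e' p.
Proof.
elim: p e e' => [m n|m n||p IHp q IHq|p IHp] e e' ee' //=.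
- by rewrite !ee'.
- by rewrite !ee'.
- by rewrite (IHp _ _ ee') (IHq _ _ ee').
- by split=> h x; [rewrite -(IHp (scons x e))|rewrite (IHp _ (scons x e'))] => // -[].
Qed.

Lemma sat_rename (V : set_structure) (p : formula) (r : nat -> nat) (e : nat -> V) :
  sat e (rename r p) <-> sat (fun n => e (r n)) p.
Proof.
elim: p r e => [m n|m n||p IHp q IHq|p IHp] r e //=.
- by rewrite IHp IHq.
- by split=> h x; move: (h x); rewrite IHp; apply sat_ext => -[].
Qed.

(** Assignments are infinite sequences; universal closures need a bound on the
    variables that matter. *)
Lemma sat_finite_support (p : formula) :
  exists n, forall (V : set_structure) (e e' : nat -> V),
    (forall m, m < n -> e m = e' m) -> sat e p <-> sat e' p.
Proof.
elim: p => [m n|m n||p [m hm] q [n hn]|p [n hn]].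
- by exists (S (m + n)) => V e e' h /=; rewrite !h //; lia.
- by exists (S (m + n)) => V e e' h /=; rewrite !h //; lia.
- by exists 0.
- exists (m + n) => V e e' h /=.
  by rewrite (hm V e e') ?(hn V e e') // => i hi; apply: h; lia.
- exists n => V e e' h /=.
  by split=> hp x; move: (hp x); apply hn => -[|i] hi //=; rewrite h //; lia.
Qed.

Section Expressible.
Context {I : Type} (S : I -> set_structure).

(** A slot of a formula is filled either by a variable of the assignment or by a
    constant. A constant has one value in each structure of the family [S]. *)
Definition value (i : I) (e : nat -> S i) (r : nat + (forall i, S i)) : S i :=
  match r with inl n => e n | inr c => c i end.

(** One formula for all structures of a family. With a single structure, constants
    are parameters and this is definability, as in the schemas of separation and
    replacement; over all structures, it is the uniformity that elementarity
    requires. Keeping constants apart from variables makes the lemmas below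
    compositional, so that [express] can apply them blindly. *)
Definition expressible (Q : forall i, (nat -> S i) -> Prop) : Prop :=
  exists (p : formula) (r : nat -> nat + (forall i, S i)),
    forall i e, Q i e <-> sat (fun n => value e (r n)) p.

Definition term (t : forall i, (nat -> S i) -> S i) : Prop :=
  exists r, forall i e, t i e = value e r.

Lemma term_var n : term (fun i e => e n).
Proof. by exists (inl n). Qed.

Lemma term_const (c : forall i, S i) : term (fun i e => c i).
Proof. by exists (inr c). Qed.

Lemma expressible_mem t u :
  term t -> term u -> expressible (fun i e => t i e in_ u i e).
Proof.
move=> [r hr] [s hs].
exists (f_mem 0 1), (fun n => match n with O => r | _ => s end) => i e /=.
by rewrite hr hs.
Qed.

Lemma expressible_eq t u :
  term t -> term u -> expressible (fun i e => t i e = u i e).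
Proof.
move=> [r hr] [s hs].
exists (f_eq 0 1), (fun n => match n with O => r | _ => s end) => i e /=.
by rewrite hr hs.
Qed.

Lemma expressible_false : expressible (fun i e => False).
Proof. by exists f_bot, (fun n => inl n). Qed.

(** The two formulas come with their own slots; renaming sends those of the first
    to the even numbers and those of the second to the odd ones. *)
Lemma expressible_imp P Q :
  expressible P -> expressible Q -> expressible (fun i e => P i e -> Q i e).
Proof.
move=> [p [r hp]] [q [s hq]].
exists (f_imp (rename (fun n => n + n) p) (rename (fun n => n + n + 1) q)).
exists (fun n => if Nat.even n then r (Nat.div2 n) else s (Nat.div2 n)) => i e /=.
rewrite hp hq !sat_rename.
have ev n : Nat.even (n + n) = true by apply Nat.even_spec; exists n; lia.
have od n : Nat.even (n + n + 1) = false.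
  by rewrite -Nat.negb_odd; have -> : Nat.odd (n + n + 1) = true
    by apply Nat.odd_spec; exists n; lia.
have hd n : Nat.div2 (n + n) = n.
  by have -> : n + n = 2 * n by [lia]; apply: Nat.div2_double.
have hd1 n : Nat.div2 (n + n + 1) = n.
  by have -> : n + n + 1 = Datatypes.S (2 * n) by [lia]; apply: Nat.div2_succ_double.
have hp' : sat (fun n => value e (r n)) p <-> sat (fun n => value e
   (if Nat.even (n + n) then r (Nat.div2 (n + n)) else s (Nat.div2 (n + n)))) p.
  by apply: sat_ext => n; rewrite ev hd.
have hq' : sat (fun n => value e (s n)) q <-> sat (fun n => value e
   (if Nat.even (n + n + 1) then r (Nat.div2 (n + n + 1)) else s (Nat.div2 (n + n + 1)))) q.
  by apply: sat_ext => n; rewrite od hd1.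
tauto.
Qed.

(** Variable 0 is bound, so every slot holding it becomes the index 0 and the other
    slots are shifted, together with the variables that they hold. *)
Lemma expressible_all (Q : forall i, S i -> (nat -> S i) -> Prop) :
  expressible (fun i e => Q i (e 0) (fun n => e (Datatypes.S n))) ->
  expressible (fun i e => forall x : S i, Q i x e).
Proof.
move=> [p [r hp]].
exists (f_all (rename (fun n => match r n with inl O => 0 | _ => Datatypes.S n end) p)).
exists (fun n => match r n with inl m => inl (Nat.pred m) | inr c => inr c end) => i e /=.
have hx x : Q i x e <-> sat (scons x (fun n => value e
     match r n with inl m => inl (Nat.pred m) | inr c => inr c end))
   (rename (fun n => match r n with inl O => 0 | _ => Datatypes.S n end) p).
  rewrite sat_rename (hp i (scons x e)).
  by apply: sat_ext => n; case hn: (r n) => [[|m]|c] //=; rewrite hn.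
by split=> h x; apply/hx.
Qed.

Lemma expressible_iff P Q :
  (forall i e, P i e <-> Q i e) -> expressible P -> expressible Q.
Proof. by move=> PQ [p [r hp]]; exists p, r => i e; rewrite -PQ. Qed.

Lemma expressible_not P : expressible P -> expressible (fun i e => ~ P i e).
Proof. by move=> hP; apply: expressible_imp => //; apply: expressible_false. Qed.

Lemma expressible_or P Q :
  expressible P -> expressible Q -> expressible (fun i e => P i e \/ Q i e).
Proof.
move=> hP hQ; apply: (expressible_iff (P := fun i e => ~ P i e -> Q i e)).
  by move=> i e; tauto.
by apply: expressible_imp => //; apply: expressible_not.
Qed.

Lemma expressible_and P Q :
  expressible P -> expressible Q -> expressible (fun i e => P i e /\ Q i e).
Proof.
move=> hP hQ; apply: (expressible_iff (P := fun i e => ~ (P i e -> ~ Q i e))).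
  by move=> i e; tauto.
by apply/expressible_not/expressible_imp => //; apply: expressible_not.
Qed.

Lemma expressible_equiv P Q :
  expressible P -> expressible Q -> expressible (fun i e => P i e <-> Q i e).
Proof. by move=> hP hQ; apply: expressible_and; apply: expressible_imp. Qed.

Lemma expressible_ex (Q : forall i, S i -> (nat -> S i) -> Prop) :
  expressible (fun i e => Q i (e 0) (fun n => e (Datatypes.S n))) ->
  expressible (fun i e => exists x : S i, Q i x e).
Proof.
move=> hQ; apply: (expressible_iff (P := fun i e => ~ forall x, ~ Q i x e)).
  move=> i e; split; first exact: not_all_not_ex.
  by move=> [x hx] h; apply: (h x).
by apply/expressible_not/expressible_all/expressible_not.
Qed.

Lemma expressible_ex2 (P Q : forall i, S i -> (nat -> S i) -> Prop) :
  expressible (fun i e => P i (e 0) (fun n => e (Datatypes.S n))) ->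
  expressible (fun i e => Q i (e 0) (fun n => e (Datatypes.S n))) ->
  expressible (fun i e => exists2 x : S i, P i x e & Q i x e).
Proof.
move=> hP hQ; apply: (expressible_iff (P := fun i e => exists x, P i x e /\ Q i x e)).
  by move=> i e; split=> [[x []]|[x]]; exists x.
by apply/expressible_ex/expressible_and.
Qed.

Lemma expressible_exu (Q : forall i, S i -> (nat -> S i) -> Prop) :
  expressible (fun i e => Q i (e 0) (fun n => e (Datatypes.S n))) ->
  expressible (fun i e => Q i (e 0) (fun n => e (Datatypes.S (Datatypes.S n)))) ->
  expressible (fun i e => exists! x : S i, Q i x e).
Proof.
move=> hQ hQ'; apply/expressible_ex/expressible_and => //.
apply: expressible_all; apply: expressible_imp => //.
by apply: expressible_eq; apply: term_var.
Qed.

(** Substitution of terms for the variables of a predicate whose expressibility is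
    a hypothesis. *)
Lemma expressible_class (P : forall i, S i -> Prop) :
  expressible (fun i e => P i (e 0)) ->
  forall t, term t -> expressible (fun i e => P i (t i e)).
Proof.
move=> [p [r hp]] t [tr ht].
exists p, (fun n => match r n with inl _ => tr | inr c => inr c end) => i e.
rewrite (hp i (fun _ => t i e)).
by apply: sat_ext => n; case: (r n) => [m|c] //=; rewrite ht.
Qed.

Lemma expressible_relation (R : forall i, S i -> S i -> Prop) :
  expressible (fun i e => R i (e 0) (e 1)) ->
  forall t u, term t -> term u -> expressible (fun i e => R i (t i e) (u i e)).
Proof.
move=> [p [r hp]] t u [tr ht] [ur hu].
exists p, (fun n => match r n with inl O => tr | inl _ => ur | inr c => inr c end) => i e.
rewrite (hp i (scons (t i e) (fun _ => u i e))).
by apply: sat_ext => n; case: (r n) => [[|m]|c] //=; rewrite ?ht ?hu.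
Qed.

End Expressible.

(** [express] decomposes a predicate along its connectives, unfolding definitions
    by conversion; hypotheses about variable predicates are used as atoms. *)
Ltac express_term := first [exact: term_var | refine (term_const _)].
Ltac express_atom := match goal with
  | H : @expressible unit (fun _ => _) (fun _ e => ?P (e 0)) |- _ =>
      refine (expressible_class (P := fun _ => P) H _); express_term
  | H : @expressible unit (fun _ => _) (fun _ e => ?R (e 0) (e 1)) |- _ =>
      refine (expressible_relation (R := fun _ => R) H _ _); express_term
  end.
Ltac express := cbv beta; first
  [ express_atom
  | refine (expressible_and _ _); express
  | refine (expressible_equiv _ _); express
  | refine (expressible_or _ _); express
  | refine (expressible_ex2 _ _); express
  | refine (expressible_exu _ _); express
  | refine (expressible_ex _); express
  | exact: expressible_false
  | refine (expressible_eq _ _); express_term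
  | refine (expressible_mem _ _); express_term
  | refine (expressible_not _); express
  | refine (expressible_imp _ _); express
  | refine (expressible_all _); express ].

Notation class P := (@expressible unit (fun _ => _) (fun _ e => P (e 0))).
Notation relation R := (@expressible unit (fun _ => _) (fun _ e => R (e 0) (e 1))).


(** The form taken by the instances of the schemas: two variables first, then the
    parameters. The default [d] fills the positions that hold no parameter. *)
Lemma expressible_formula (V : set_structure) (R : V -> V -> Prop) (d : V) :
  relation R -> exists p e, forall u v, R u v <-> sat (scons u (scons v e)) p.
Proof.
move=> [p [r hp]].
exists (rename (fun n => match r n with inl O => 0 | inl 1 => 1 | _ => S (S n) end) p).
exists (fun n => match r n with inl _ => d | inr c => c tt end) => u v.
rewrite sat_rename (hp tt (scons u (scons v (fun _ => d)))).
by apply: sat_ext => n; case hn: (r n) => [[|[|m]]|c] //=; rewrite hn.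
Qed.

(** * Elementary set theory *)

Section SetTheory.
Variables (V : set_structure) (hV : ZFC V).

Lemma set_ext (x y : V) : (forall z, z in_ x <-> z in_ y) -> x = y.
Proof. by case: hV => h _; exact: h. Qed.

Lemma set_foundation (x : V) :
  ~ is_empty x -> exists2 y, y in_ x & forall z, z in_ y -> ~ z in_ x.
Proof. by case: hV => _ [h _]; exact: h. Qed.
Arguments set_foundation x _ : clear implicits.

Lemma ex_upair (x y : V) : exists u, is_upair u x y.
Proof. by case: hV => _ [_ [h _]]; exact: h. Qed.

Lemma ex_powerset (x : V) : exists u, is_powerset u x.
Proof. by case: hV => _ [_ [_ [_ [h _]]]]; exact: h. Qed.

Lemma comprehension (P : V -> Prop) (x : V) :
  class P -> exists y, forall z, z in_ y <-> z in_ x /\ P z.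
Proof.
move=> hP; have hR : relation (fun z _ => P z) by express.
have [p [e he]] := expressible_formula (R := fun z _ => P z) x hR.
case: hV => _ [_ [_ [_ [_ [_ [sep _]]]]]].
(* A class is a relation in its first argument; [x] fills the second one. *)
by have [y hy] := sep p (scons x e) x; exists y => z; rewrite hy -(he z x).
Qed.
Arguments comprehension P _ _ : clear implicits.

Lemma class_replacement (R : V -> V -> Prop) (x : V) :
  relation R -> (forall u, u in_ x -> exists! v, R u v) ->
  exists y, forall v, v in_ y <-> exists2 u, u in_ x & R u v.
Proof.
move=> hR hx; have [p [e he]] := expressible_formula x hR.
case: hV => _ [_ [_ [_ [_ [_ [_ [repl _]]]]]]].
have [|y hy] := repl p e x.
  move=> u /hx [v [huv hv]]; exists v; split; first by rewrite -he.
  by move=> w; rewrite -he; exact: hv.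
by exists y => v; rewrite hy; split=> -[u hu]; [rewrite -he|rewrite he]; exists u.
Qed.
Arguments class_replacement R _ _ _ : clear implicits.

Lemma ex_empty (x : V) : exists o : V, is_empty o.
Proof.
have [|o ho] := comprehension (fun _ => False) x; first by express.
by exists o => z /ho [].
Qed.

Lemma ex_binary_union (x y : V) : exists u, forall z, z in_ u <-> z in_ x \/ z in_ y.
Proof.
have [p hp] := ex_upair x y.
case: hV => _ [_ [_ [un _]]]; have [u hu] := un p.
exists u => z; rewrite hu; split.
  by move=> [w /hp [->|->]]; [left|right].
by move=> [hz|hz]; [exists x|exists y] => //; apply/hp; [left|right].
Qed.

Lemma min_element (P : V -> Prop) (x : V) :
  class P -> (exists2 y, y in_ x & P y) ->
  exists y, y in_ x /\ P y /\ forall z, z in_ x -> z in_ y -> ~ P z.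
Proof.
move=> hP [y yx Py]; have [s hs] := comprehension P x hP.
have [|m /hs [mx Pm] hm] := set_foundation s.
  by move=> h; apply: (h y); apply/hs.
by exists m; do 2!split=> //; move=> z zx zm Pz; apply: (hm z zm); apply/hs.
Qed.
Arguments min_element P _ _ _ : clear implicits.

Lemma mem_irrefl (x : V) : ~ x in_ x.
Proof.
move=> xx; have [u hu] := ex_upair x x.
have [|y /hu hy h] := set_foundation u; first by move=> h; apply: (h x); apply/hu; left.
have e : y = x by tauto.
by subst y; apply: (h x xx); apply/hu; left.
Qed.

Lemma mem_asym (x y : V) : x in_ y -> ~ y in_ x.
Proof.
move=> xy yx; have [u hu] := ex_upair x y.
have [|m /hu hm h] := set_foundation u; first by move=> h; apply: (h x); apply/hu; left.
case: hm => e; subst m; first by apply: (h y) => //; apply/hu; right.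
by apply: (h x) => //; apply/hu; left.
Qed.

(** ** Ordered pairs *)

Lemma is_upair_unique (u v x y : V) : is_upair u x y -> is_upair v x y -> u = v.
Proof. by move=> hu hv; apply: set_ext => z; rewrite hu hv. Qed.

Lemma ex_pair (x y : V) : exists p, is_pair p x y.
Proof.
have [a ha] := ex_upair x x; have [b hb] := ex_upair x y.
by have [p hp] := ex_upair a b; exists p, a, b.
Qed.

Lemma is_pair_unique (p q x y : V) : is_pair p x y -> is_pair q x y -> p = q.
Proof.
move=> [a [b [ha [hb hp]]]] [a' [b' [ha' [hb' hq]]]].
have ea := is_upair_unique ha ha'; have eb := is_upair_unique hb hb'.
by subst a' b'; apply: is_upair_unique hp hq.
Qed.

Lemma is_pair_inj (p x y x' y' : V) :
  is_pair p x y -> is_pair p x' y' -> x = x' /\ y = y'.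
Proof.
move=> [a [b [ha [hb hp]]]] [a' [b' [ha' [hb' hp']]]].
have ex : x = x'.
  have : a = a' \/ a = b' by apply/hp'/hp; left.
  case=> e; subst.
    by have : x = x' \/ x = x' by [apply/ha'/ha; left]; tauto.
  by have : x' = x \/ x' = x by [apply/ha/hb'; left]; case=> ->.
subst x'; split=> //.
have ab : a = a' by apply: is_upair_unique ha ha'.
subst a'.
have : b = a \/ b = b' by apply/hp'/hp; right.
have : b' = a \/ b' = b by apply/hp/hp'; right.
have : y in_ b by apply/hb; right.
have : y' in_ b' by apply/hb'; right.
move=> h1 h2 [e1|e1] [e2|e2]; subst.
- by move: h1 h2 => /ha h1 /ha h2; transitivity x; [case: h2 | case: h1].
- by move: h1 h2 => /ha h1 /ha h2; transitivity x; [case: h2 | case: h1].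
- move: h2 => /ha h2; move: h1 => /ha h1.
  by transitivity x; [case: h2 | case: h1].
- move: h1 => /hb [e|//]; move: h2 => /hb' [e'|//]; by rewrite e e'.
Qed.

Lemma maps_pair (f p x y : V) : is_pair p x y -> maps f x y <-> p in_ f.
Proof.
move=> hp; split=> [[q hq]|pf]; last by exists p.
by rewrite (is_pair_unique hq hp).
Qed.

(** Every pair of elements of [u] belongs to the double power set of [u], in
    which the product is carved out by comprehension. *)
Lemma is_pair_subset_powerset (p x y u : V) :
  is_pair p x y -> x in_ u -> y in_ u -> forall w, w in_ p -> subset w u.
Proof.
by move=> [a [b [ha [hb hp]]]] xu yu w /hp [->|->] z; [move/ha|move/hb] => -[]->.
Qed.

Lemma ex_product (A B : V) :
  exists X, forall p, p in_ X <-> exists x y, x in_ A /\ y in_ B /\ is_pair p x y.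
Proof.
have [u hu] := ex_binary_union A B.
have [P hP] := ex_powerset u; have [PP hPP] := ex_powerset P.
have [|X hX] := comprehension
  (fun p => exists x y, x in_ A /\ y in_ B /\ is_pair p x y) PP; first by express.
exists X => p; rewrite hX; split=> [[]//|h]; split=> //; apply/hPP => w wp.
apply/hP; case: h => [x [y [xA [yB xy]]]].
by apply: (is_pair_subset_powerset xy _ _ wp); apply/hu; [left|right].
Qed.

(** Sets of pairs, given by their values [maps f x y]. *)
Lemma relation_comprehension (R : V -> V -> Prop) (A B : V) :
  relation R ->
  exists f, (forall p, p in_ f -> exists x y, x in_ A /\ y in_ B /\ is_pair p x y) /\
    forall x y, maps f x y <-> x in_ A /\ y in_ B /\ R x y.
Proof.
move=> hR; have [X hX] := ex_product A B.
have [|f hf] := comprehension (fun p => exists x y, is_pair p x y /\ R x y) X.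
  by express.
exists f; split=> [p /hf [/hX //]|x y].
have [p hp] := ex_pair x y; rewrite (maps_pair f hp) hf hX; split.
  move=> [[x1 [y1 [xA [yB h1]]]] [x2 [y2 [h2 r]]]].
  have [? ?] := is_pair_inj hp h1; have [? ?] := is_pair_inj hp h2.
  by subst.
by move=> [xA [yB r]]; split; exists x, y.
Qed.
Arguments relation_comprehension R _ _ _ : clear implicits.

(** [f] is an injective function from [A] to [B]. *)
Definition injection {S : set_structure} (f A B : S) :=
  function f A B /\ forall x x' y, maps f x y -> maps f x' y -> x = x'.

Definition injects {S : set_structure} (A B : S) := exists f, injection f A B.

Lemma ex_function (R : V -> V -> Prop) (A B : V) :
  relation R -> (forall x, x in_ A -> exists! y, y in_ B /\ R x y) ->
  exists f, function f A B /\ forall x y, maps f x y <-> x in_ A /\ y in_ B /\ R x y.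
Proof.
move=> hR hA; have [f [fp hf]] := relation_comprehension R A B hR.
exists f; split=> //; split; last by move=> x y /hf [_ []].
split=> [p /fp [x [y [xA [_ h]]]]|x xA]; first by exists x, y.
have [y [[yB r] hy]] := hA x xA; exists y; split; first by apply/hf.
by move=> z /hf [_ ?]; exact: hy.
Qed.
Arguments ex_function R _ _ _ _ : clear implicits.

Lemma ex_injection (R : V -> V -> Prop) (A B : V) :
  relation R -> (forall x, x in_ A -> exists! y, y in_ B /\ R x y) ->
  (forall x x' y, x in_ A -> x' in_ A -> y in_ B -> R x y -> R x' y -> x = x') ->
  injects A B.
Proof.
move=> hR hA inj; have [f [ff hf]] := ex_function R A B hR hA.
exists f; split=> // x x' y /hf [? [? ?]] /hf [? [? ?]]; exact: (inj x x' y).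
Qed.
Arguments ex_injection R _ _ _ _ _ : clear implicits.

(** Replacement supplies a codomain for a functional class. *)
Lemma ex_function_on (R : V -> V -> Prop) (A : V) :
  relation R -> (forall x, x in_ A -> exists! y, R x y) ->
  exists f, function_on f A /\ forall x y, maps f x y <-> x in_ A /\ R x y.
Proof.
move=> hR hA; have [B hB] := class_replacement R A hR hA.
have [|f [[ff _] hf]] := ex_function R A B hR.
  move=> x xA; have [y [r hy]] := hA x xA; exists y; split.
    by split=> //; apply/hB; exists x.
  by move=> z [_ /hy].
exists f; split=> // x y; rewrite hf; split=> [[? []]//|[xA r]]; do 2!split=> //.
by apply/hB; exists x.
Qed.
Arguments ex_function_on R _ _ _ : clear implicits.

Lemma function_on_val (f A x y z : V) :
  function_on f A -> maps f x y -> maps f x z -> y = z.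
Proof.
move=> [dom fun_f] xy xz.
have xA : x in_ A.
  case: (xy) => p hp /dom [x' [y' [x'A hp']]].
  by have [-> _] := is_pair_inj hp hp'.
by have [w [_ hw]] := fun_f x xA; rewrite -(hw y xy) (hw z xz).
Qed.

Lemma function_on_dom (f A x y : V) : function_on f A -> maps f x y -> x in_ A.
Proof.
move=> [dom _] [p hp /dom [x' [y' [x'A hp']]]].
by have [-> _] := is_pair_inj hp hp'.
Qed.

Lemma injects_trans (A B C : V) : injects A B -> injects B C -> injects A C.
Proof.
move=> [f [[ff fB] fi]] [g [[gg gC] gi]].
apply: (ex_injection (fun x z => exists y, maps f x y /\ maps g y z)).
- by express.
- move=> x xA; case: (ff) => _ /(_ x xA) [y [xy _]].
  case: (gg) => _ /(_ y (fB _ _ xy)) [z [yz _]].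
  exists z; split; first by split; [exact: gC yz | exists y].
  move=> z' [_ [y' [xy' yz']]].
  rewrite (function_on_val ff xy' xy) in yz'.
  exact: (function_on_val gg yz yz').
- move=> x x' z _ _ _ [y [xy yz]] [y' [xy' yz']].
  rewrite (gi _ _ _ yz' yz) in xy'; exact: fi xy xy'.
Qed.

Lemma subset_injects (A B : V) : subset A B -> injects A B.
Proof.
move=> AB; apply: (ex_injection (fun x y => x = y)); first by express.
  by move=> x xA; exists x; split; [split=> //; exact: AB | move=> y []].
by move=> x x' y _ _ _ -> ->.
Qed.

Lemma equinumerous_injects (A B : V) : equinumerous A B -> injects A B.
Proof.
move=> [f [[ff fB] fi]]; exists f; split=> // x x' y xy xy'.
by have [w [_ hw]] := fi y (fB _ _ xy); rewrite -(hw x xy) (hw x' xy').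
Qed.

Lemma equinumerous_injects_sym (A B : V) : equinumerous A B -> injects B A.
Proof.
move=> [f [[ff fB] fi]]; apply: (ex_injection (fun y x => maps f x y)).
- by express.
- move=> y /fi [x [xy hx]]; exists x; split; last by move=> x' [_ /hx].
  by split=> //; exact: function_on_dom ff xy.
- by move=> y y' x _ _ _ xy xy'; apply: function_on_val ff xy xy'.
Qed.

(** ** Choice functions *)

(** The sets [{Y} * {y | R Y y}] are pairwise disjoint; a set meeting each of
    them in one point is the graph of a choice function. *)
Lemma ex_choice_function (R : V -> V -> Prop) (A B : V) :
  relation R -> (forall x, x in_ A -> exists2 y, y in_ B & R x y) ->
  exists C, function C A B /\ forall x y, maps C x y -> R x y.
Proof.
move=> hR hA; have [X hX] := ex_product A B; have [PX hPX] := ex_powerset X.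
have [|F hF] := comprehension (fun Z => exists2 x, x in_ A & forall p, p in_ Z <->
   exists2 y, y in_ B /\ R x y & is_pair p x y) PX; first by express.
have choice_V : choice V by case: hV => _ [_ [_ [_ [_ [_ [_ [_ ]]]]]]].
have [||c hc] := choice_V F.
{ move=> Z /hF [_ [x xA hZ]]; have [y yB r] := hA x xA.
  by have [p hp] := ex_pair x y; move=> h; apply: (h p); apply/hZ; exists y. }
{ move=> Z Z' p /hF [_ [x xA hZ]] /hF [_ [x' x'A hZ']] pZ pZ'.
  have [y _ hy] := (proj1 (hZ p) pZ); have [y' _ hy'] := (proj1 (hZ' p) pZ').
  have [? _] := is_pair_inj hy hy'; subst x'.
  by apply: set_ext => q; rewrite hZ hZ'. }
have [||C [hC1 hC2]] := ex_function (fun x y => R x y /\ exists2 p, is_pair p x y & p in_ c) A B.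
{ by express. }
{ move=> x xA.
  have [|Z hZ] := comprehension (fun p => exists2 y, y in_ B /\ R x y & is_pair p x y) X.
    by express.
  have hZ' p : p in_ Z <-> exists2 y, y in_ B /\ R x y & is_pair p x y.
    rewrite hZ; split=> [[]//|h]; split=> //; apply/hX.
    by case: h => y [yB _] hp; exists x, y.
  have ZF : Z in_ F by apply/hF; split; [apply/hPX => p /hZ [] | exists x].
  have [p [[/hZ' [y [yB r] hp] pc] up]] := hc Z ZF.
  exists y; split; first by split=> //; split=> //; exists p.
  move=> y' [y'B [r' [p' hp' p'c]]].
  have e : p = p' by apply: up; split=> //; apply/hZ'; exists y'.
  by subst p'; have [] := is_pair_inj hp hp'. }
by exists C; split=> // x y /hC2 [_ [_ []]].
Qed.
Arguments ex_choice_function R _ _ _ _ : clear implicits.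

(** ** Ordinals *)

Lemma ordinal_mem (a b : V) : ordinal a -> b in_ a -> ordinal b.
Proof.
move=> [ta ha] ba; split; first exact: ha.
by move=> c cb; apply: ha; apply: ta cb.
Qed.

Lemma ordinal_trans (a b c : V) : ordinal c -> a in_ b -> b in_ c -> a in_ c.
Proof. by move=> [tc _] ab bc; apply: tc ab. Qed.

Lemma ordinal_induction (P : V -> Prop) :
  class P ->
  (forall a, ordinal a -> (forall b, b in_ a -> P b) -> P a) ->
  forall a, ordinal a -> P a.
Proof.
move=> hP step a oa; apply: NNPP => nPa.
have [[b ba nPb]|h] := classic (exists2 b, b in_ a & ~ P b).
  have hnP : class (fun x => ~ P x) by express.
  have [|m [ma [nPm hm]]] := min_element (fun x => ~ P x) a hnP; first by exists b.
  apply: nPm; apply: step; first exact: ordinal_mem oa ma.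
  move=> c cm; apply: NNPP; exact: (hm c (ordinal_trans oa cm ma) cm).
by apply: nPa; apply: step => // b ba; apply: NNPP => nPb; apply: h; exists b.
Qed.
Arguments ordinal_induction P _ _ _ _ : clear implicits.

(** By two nested inductions, the elements of [a] are comparable with [b] and those
    of [b] with [a]; if [a] and [b] are not, then they have the same elements. *)
Lemma ordinal_trichotomy (a b : V) :
  ordinal a -> ordinal b -> a in_ b \/ a = b \/ b in_ a.
Proof.
move=> oa; move: a oa b.
refine (ordinal_induction (fun a => forall b, ordinal b -> a in_ b \/ a = b \/ b in_ a) _ _).
  by express.
move=> a oa IHa.
refine (ordinal_induction (fun b => a in_ b \/ a = b \/ b in_ a) _ _); first by express.
move=> b ob IHb; apply: NNPP => h; apply: (h); right; left; apply: set_ext => z; split=> hz.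
- case: (IHa z hz b ob) => [//|[e|bz]]; exfalso; apply: h; right; right.
    by subst z.
  exact: ordinal_trans oa bz hz.
- case: (IHb z hz) => [az|[e|//]]; exfalso; apply: h; left.
    exact: ordinal_trans ob az hz.
  by subst z.
Qed.

Lemma ordinal_mem_or_subset (a b : V) :
  ordinal a -> ordinal b -> a in_ b \/ subset b a.
Proof.
move=> oa ob; case: (ordinal_trichotomy oa ob) => [|[->|ba]]; [by left|by right|].
by right; case: oa => ta _; exact: ta.
Qed.

(** ** Enumerating a set along an ordinal *)

(** Recursion by partial solutions: [g] enumerates below [a] if each of its
    values at [b] in [a] is the element that [C] picks from what the earlier
    values leave of [X]. Such a [g] may be arbitrary from [a] on, so it need not
    be restricted when [a] decreases, and any two of them agree below [a]. *)
Section Enumeration.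
Variables X C : V.

Definition remainder (g a Y : V) : Prop :=
  forall z, z in_ Y <-> z in_ X /\ forall b, b in_ a -> ~ maps g b z.

Definition enumerates_below (g a : V) : Prop :=
  forall b, b in_ a -> forall y,
    maps g b y <-> exists2 Y, remainder g b Y & maps C Y y.

Definition enumerated_at (a y : V) : Prop :=
  ordinal a /\ exists g, enumerates_below g a /\
    exists2 Y, remainder g a Y & maps C Y y.

Lemma remainder_ext (g h a Y : V) :
  (forall b z, b in_ a -> maps g b z <-> maps h b z) ->
  remainder g a Y -> remainder h a Y.
Proof.
move=> gh hY z; rewrite hY; split=> -[zX hz]; split=> // b ba.
  by rewrite -gh //; exact: hz.
by rewrite gh //; exact: hz.
Qed.

Lemma enumerates_below_mem (g a b : V) :
  ordinal a -> b in_ a -> enumerates_below g a -> enumerates_below g b.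
Proof. move=> oa ba hg c cb; apply: hg; exact: ordinal_trans oa cb ba. Qed.

Lemma enumerates_below_unique (g h a : V) :
  ordinal a -> enumerates_below g a -> enumerates_below h a ->
  forall b y, b in_ a -> maps g b y <-> maps h b y.
Proof.
move=> oa hg hh b y ba; move: (ba) y; have := ordinal_mem oa ba; move: b {ba}.
refine (ordinal_induction
  (fun b => b in_ a -> forall y, maps g b y <-> maps h b y) _ _); first by express.
move=> b ob IH ba y.
have gh c z : c in_ b -> maps g c z <-> maps h c z.
  by move=> cb; apply: IH => //; exact: ordinal_trans oa cb ba.
rewrite hg // hh //; split=> -[Y hY]; exists Y => //.
  exact: remainder_ext gh hY.
by apply: remainder_ext hY => c z /gh ->.
Qed.

Lemma enumerates_belowE (g a b y : V) :
  ordinal a -> enumerates_below g a -> b in_ a ->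
  maps g b y <-> enumerated_at b y.
Proof.
move=> oa hg ba; have ob := ordinal_mem oa ba.
have hgb := enumerates_below_mem oa ba hg.
rewrite hg //; split=> [[Y hY CY]|[_ [h [hh [Y hY CY]]]]].
  by split=> //; exists g; split=> //; exists Y.
exists Y => //; apply: remainder_ext hY => c z cb.
exact: enumerates_below_unique ob hh hgb _ _ cb.
Qed.

End Enumeration.

(** Zermelo's theorem with control on the enumeration: [R] prescribes which
    elements may come next. The positions at which some element is enumerated
    form a set by replacement, because no element is enumerated twice; they form
    an ordinal [D]. If something were left over at [D], then [D] would itself be
    such a position. *)
Lemma ex_enumeration (R : V -> V -> Prop) (X : V) :
  relation R ->
  (forall Y, subset Y X -> ~ is_empty Y -> exists2 y, y in_ Y & R Y y) ->
  exists a g, ordinal a /\ bijection g a X /\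
    forall b y, maps g b y -> exists2 Y, remainder X g b Y & R Y y.
Proof.
move=> hR hX; have [PX hPX] := ex_powerset X.
have [|A hA] := comprehension (fun Y => ~ is_empty Y) PX; first by express.
have [||C [[Cf CX] CR]] := ex_choice_function (fun Y y => y in_ Y /\ R Y y) A X.
{ by express. }
{ move=> Y /hA [/hPX YX Y0]; have [y yY r] := hX Y YX Y0.
  by exists y => //; exact: YX. }
have CE Y y y' : maps C Y y -> maps C Y y' -> y = y' by exact: (function_on_val Cf).
pose E := enumerated_at X C.
have EX b y : E b y -> y in_ X.
  by move=> [_ [g [_ [Y hY /CR [/hY [] //]]]]].
have Euniq b y y' : E b y -> E b y' -> y = y'.
  move=> [ob [g [hg [Y hY CY]]]] [_ [g' [hg' [Y' hY' CY']]]].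
  have e : Y = Y'.
    apply: set_ext => z; rewrite hY'; apply: (remainder_ext _ hY) => c w cb.
    exact: enumerates_below_unique ob hg hg' _ _ cb.
  by subst Y'; exact: CE CY CY'.
have Elt b c y : E b y -> E c y -> ~ b in_ c.
  move=> Eb [oc [g [hg [Y hY /CR [/hY [_ yY] _]]]]] bc.
  by apply: (yY b bc); apply/(enumerates_belowE _ oc hg bc).
have Einj b c y : E b y -> E c y -> b = c.
  move=> Eb Ec; case: (ordinal_trichotomy (proj1 Eb) (proj1 Ec)) => [bc|[//|cb]].
    by case: (Elt _ _ _ Eb Ec bc).
  by case: (Elt _ _ _ Ec Eb cb).
have [|X' hX'] := comprehension (fun y => exists b, E b y) X; first by express.
have [||D hD] := class_replacement (fun y b => E b y) X'.
{ by express. }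
{ by move=> y /hX' [_ [b hb]]; exists b; split=> // c; exact: Einj. }
have DE b : b in_ D <-> exists y, E b y.
  rewrite hD; split=> [[y _ hy]|[y hy]]; exists y => //.
  by apply/hX'; split; [exact: EX hy|exists b].
have oD : ordinal D.
  split; last by move=> b /DE [y [[tb _] _]].
  move=> b /DE [y [ob [g [hg [Y hY CY]]]]] c cb; apply/DE.
  have [|Z hZ] := comprehension (fun z => forall d, d in_ c -> ~ maps g d z) X.
    by express.
  have ZA : Z in_ A.
    apply/hA; split; first by apply/hPX => z /hZ [].
    move=> /(_ y); apply; apply/hZ; move: CY => /CR [/hY [yX yg] _].
    by split=> // d dc; apply: yg; exact: ordinal_trans ob dc cb.
  case: (Cf) => _ /(_ Z ZA) [z [CZ _]]; exists z; split; first exact: ordinal_mem ob cb.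
  exists g; split; last by exists Z.
  exact: enumerates_below_mem ob cb hg.
have [||g [[gD gX] hg]] := ex_function E D X.
{ by express. }
{ move=> b /DE [y hy]; exists y; split; first by split=> //; exact: EX hy.
  by move=> y' [_]; exact: Euniq. }
have gE b y : maps g b y <-> E b y.
  rewrite hg; split=> [[_ []]//|h].
  by split; [apply/DE; exists y | split; [exact: EX h|]].
have same h b c z : enumerates_below X C h b -> ordinal b -> c in_ b ->
    maps h c z <-> maps g c z.
  by move=> hh ob cb; rewrite gE; exact: (enumerates_belowE _ ob hh cb).
have gD' : enumerates_below X C g D.
  move=> b /DE [y0 [ob [h [hh _]]]] y; rewrite gE; split.
    move=> [_ [h' [hh' [Y hY CY]]]]; exists Y => //.
    by apply: remainder_ext hY => c z; exact: same.
  move=> [Y hY CY]; split=> //; exists h; split=> //; exists Y => //.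
  by apply: remainder_ext hY => c z cb; rewrite (same h b).
exists D, g; split=> //; split.
  split; first by [].
  move=> y yX; apply: NNPP => hy.
  have [|Y hY] := comprehension (fun z => forall d, d in_ D -> ~ maps g d z) X.
    by express.
  have YA : Y in_ A.
    apply/hA; split; first by apply/hPX => z /hY [].
    move=> /(_ y); apply; apply/hY; split=> // d _ dy; apply: hy; exists d; split=> //.
    by move=> d' /gE hd'; apply: Einj hd'; apply/gE.
  case: (Cf) => _ /(_ Y YA) [z [CY _]].
  apply: (@mem_irrefl D); apply/DE; exists z; split=> //; exists g; split=> //.
  by exists Y.
move=> b y /gE [ob [h [hh [Y hY /CR [_ r]]]]]; exists Y => //.
by apply: remainder_ext hY => c z; exact: same.
Qed.

Lemma ex_equinumerous_ordinal (X : V) : exists2 a, ordinal a & equinumerous a X.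
Proof.
have [||a [g [oa [hg _]]]] := ex_enumeration (R := fun _ y => y = y) (X := X).
{ by express. }
{ by move=> Y _ Y0; apply: NNPP => h; apply: Y0 => y yY; apply: h; exists y. }
by exists a => //; exists g.
Qed.

(** ** Comparing sizes *)

(** The diagonal argument for the inverse of an injection of the power set. *)
Lemma cantor (P x : V) : is_powerset P x -> ~ injects P x.
Proof.
move=> hP [f [[ff fx] fi]].
have [|D hD] := comprehension (fun y => exists2 A, maps f A y & ~ y in_ A) x.
  by express.
have DP : D in_ P by apply/hP => y /hD [].
case: (ff) => _ /(_ D DP) [y [Dy _]].
have nyD : ~ y in_ D.
  move=> yD; move: (yD) => /hD [_ [A Ay]]; by rewrite (fi _ _ _ Ay Dy).
by apply: (nyD); apply/hD; split; [exact: fx Dy | exists D].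
Qed.

(** The points of [a] reached from [a \ c] by iterating the injection [f] of
    [a] into [c] are shifted along [f]; the others are left in place. *)
Lemma schroeder_bernstein (a c : V) :
  subset c a -> injects a c -> equinumerous c a.
Proof.
move=> ca [f [[ff fc] fi]].
pose closed Y := (forall z, z in_ a -> ~ z in_ c -> z in_ Y) /\
  (forall z w, z in_ Y -> maps f z w -> w in_ Y).
have [|D hD] := comprehension (fun x => forall Y, closed Y -> x in_ Y) a.
  by express.
have D1 z : z in_ a -> ~ z in_ c -> z in_ D.
  by move=> za zc; apply/hD; split=> // Y [h _]; exact: h.
have D2 z w : z in_ D -> maps f z w -> w in_ D.
  move=> /hD [za hz] zw; apply/hD; split; first exact: ca (fc _ _ zw).
  by move=> Y hY; case: (hY) => _; apply; [exact: hz hY|exact: zw].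
have D3 y : y in_ D -> y in_ c -> exists2 x, x in_ D & maps f x y.
  move=> yD yc; apply: NNPP => h.
  have [|Y hY] := comprehension (fun z => z <> y) D; first by express.
  have : y in_ Y; last by move/hY => [].
  case/hD: (yD) => _; apply; split.
    by move=> z za zc; apply/hY; split; [exact: D1|move=> e; subst z].
  move=> z w /hY [zD zy] zw; apply/hY; split; first exact: D2 zD zw.
  by move=> e; subst w; apply: h; exists z.
have [||h [hca hE]] := ex_function
  (fun y x => x in_ D /\ maps f x y \/ ~ x in_ D /\ x = y) c a.
{ by express. }
{ move=> y yc; have [yD|yD] := classic (y in_ D).
    have [x xD xy] := D3 y yD yc; exists x; split.
      by split; [case/hD: xD | left].
    move=> x' [_ [[_ x'y]|[x'D e]]]; first exact: fi xy x'y.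
    by subst x'.
  exists y; split; first by split; [exact: ca|right].
  by move=> x' [_ [[x'D x'y]|[_ //]]]; case: yD; exact: D2 x'D x'y. }
exists h; split=> // x xa; have [xD|xD] := classic (x in_ D).
  case: (ff) => _ /(_ x xa) [y [xy uy]]; exists y; split.
    by apply/hE; split; [exact: fc xy|split=> //; left].
  by move=> y' /hE [_ [_ [[_ /uy]|[]]]].
have xc : x in_ c by apply: NNPP => xc; apply: xD; exact: D1.
exists x; split; first by apply/hE; do 2!split=> //; right.
by move=> y /hE [_ [_ [[]|[]]]].
Qed.

End SetTheory.

Arguments comprehension {V} hV P x _.
Arguments min_element {V} hV P x _ _.
Arguments ex_function {V} hV R A B _ _.
Arguments ex_injection {V} hV R A B _ _ _.
Arguments ex_function_on {V} hV R A _ _.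
Arguments ex_choice_function {V} hV R A B _ _.
Arguments ex_enumeration {V} hV R X _ _.

(** * Elementary embeddings *)

(** Expressibility by a formula without parameters, the same in all structures. *)
Definition first_order := @expressible set_structure (fun S => S).

(** The empty structure shows that no slot is filled by a constant. *)
Lemma first_order_formula Q :
  first_order Q -> exists p, forall (S : set_structure) e, Q S e <-> sat e p.
Proof.
move=> [p [r hp]].
exists (rename (fun n => match r n with inl m => m | inr _ => 0 end) p) => T e.
rewrite sat_rename (hp T e); apply: sat_ext => n.
case: (r n) => [//|c]; by case: (c (SetStructure (fun _ _ : False => False))).
Qed.

(** An arbitrary formula is an atom; [r] says which variable of the context each
    of its variables stands for. *)
Lemma expressible_sat (p : formula) (r : nat -> nat)
    (E : forall S : set_structure, (nat -> S) -> nat -> S) :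
  (forall S e n, E S e n = e (r n)) -> first_order (fun S e => sat (E S e) p).
Proof.
by move=> hE; exists p, (fun n => inl (r n)) => T e; apply: sat_ext => n /=.
Qed.

Fixpoint universal_closure (n : nat) (p : formula) : formula :=
  match n with O => p | S n => f_all (universal_closure n p) end.

Lemma universal_closure_valid (V : set_structure) (p : formula) n (e : nat -> V) :
  (forall e' : nat -> V, sat e' p) -> sat e (universal_closure n p).
Proof. by move=> hp; elim: n e => [|n IHn] e //= x. Qed.

(** Instantiating the outermost quantifier first gives the variable [n - 1]. *)
Lemma sat_of_universal_closure (V : set_structure) (p : formula) n (e e' : nat -> V) :
  sat e (universal_closure n p) ->
  exists e'', (forall m, m < n -> e'' m = e' m) /\
    (forall m, e'' (n + m) = e m) /\ sat e'' p.
Proof.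
elim: n e => [|n IHn] e /=; first by move=> h; exists e; split=> // m; lia.
move=> /(_ (e' n)) /IHn [e'' [h1 [h2 h3]]]; exists e''; split; last split=> //.
  move=> m mn; have [lt|eq] : m < n \/ m = n by lia.
    exact: h1.
  by subst m; rewrite -{1}(Nat.add_0_r n) h2.
by move=> m; rewrite -Nat.add_succ_r h2.
Qed.

Section Elementary.
Variables (V : set_structure) (M : V -> Prop) (j : V -> inner M).
Hypothesis ej : elementary j.

Lemma elementary_transfer (P : forall S : set_structure, S -> S -> S -> Prop) :
  first_order (fun S e => P S (e 0) (e 1) (e 2)) ->
  forall x y z, P V x y z <-> P (inner M) (j x) (j y) (j z).
Proof.
move=> /first_order_formula [p hp] x y z.
rewrite (hp V (scons x (scons y (fun _ => z)))) (ej p _).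
rewrite (hp (inner M) (scons (j x) (scons (j y) (fun _ => j z)))).
by apply: sat_ext => -[|[|]].
Qed.

(** A formula valid in [V] under every assignment is valid in [M] under every
    assignment, also outside the range of [j]: its universal closure, over the
    finitely many variables that matter, is true in [V]. *)
Lemma elementary_valid Q (d : V) :
  first_order Q -> (forall e, Q V e) -> forall e, Q (inner M) e.
Proof.
move=> /first_order_formula [p hp] hV e.
have [n hn] := sat_finite_support p.
have hc : sat (fun _ => d) (universal_closure n p).
  by apply: universal_closure_valid => e'; apply/hp.
move: hc; rewrite (ej _ _) => /(sat_of_universal_closure e) [e' [h1 [_ h2]]].
by apply/hp; rewrite (hn _ e e') // => m mn; rewrite h1.
Qed.

(** Each axiom is one formula. An instance of a schema becomes valid under every
    assignment, because its parameters range over the whole structure. *)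
Lemma elementary_ZFC : ZFC V -> ZFC (inner M).
Proof.
move=> [h1 [h2 [h3 [h4 [h5 [h6 [h7 [h8 h9]]]]]]]].
have [d _] := h6.
have tr (A : set_structure -> Prop) : first_order (fun S _ => A S) -> A V -> A (inner M).
  move=> hA hV; apply: (elementary_valid d hA (fun _ => hV) (fun _ => j d)).
split; first by apply: tr h1; rewrite /first_order; express.
split; first by apply: tr h2; rewrite /first_order; express.
split; first by apply: tr h3; rewrite /first_order; express.
split; first by apply: tr h4; rewrite /first_order; express.
split; first by apply: tr h5; rewrite /first_order; express.
split; first by apply: tr h6; rewrite /first_order; express.
split; last split; last by apply: tr h9; rewrite /first_order; express.
- move=> p e x.
  pose Q (S : set_structure) (e : nat -> S) :=
    forall x, exists y, forall z : S, z in_ y <-> z in_ x /\ sat (scons z e) p.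
  apply: (elementary_valid (Q := Q) d _ (h7 p) e).
  apply/expressible_all/expressible_ex/expressible_all; cbv beta.
  refine (expressible_equiv _ (expressible_and _ _)); try express.
  apply: (@expressible_sat p (fun n => match n with O => O | S m => S (S (S m)) end)).
  by move=> S e' [|n].
- move=> p e x.
  pose Q (S : set_structure) (e : nat -> S) := forall x : S,
    (forall u, u in_ x -> exists! v, sat (scons u (scons v e)) p) ->
    exists y, forall v, v in_ y <-> exists2 u, u in_ x & sat (scons u (scons v e)) p.
  apply: (elementary_valid (Q := Q) d _ (h8 p) e).
  apply: expressible_all; cbv beta.
  refine (expressible_imp (expressible_all (expressible_imp _ (expressible_exu _ _)))
    (expressible_ex (expressible_all (expressible_equiv _ (expressible_ex2 _ _)))));
    try express.
  + apply: (@expressible_sat p (fun n =>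
      match n with O => 1 | S O => 0 | S (S m) => S (S (S m)) end)).
    by move=> S e' [|[|n]].
  + apply: (@expressible_sat p (fun n =>
      match n with O => 2 | S O => 0 | S (S m) => S (S (S (S m))) end)).
    by move=> S e' [|[|n]].
  + apply: (@expressible_sat p (fun n =>
      match n with O => 0 | S O => 1 | S (S m) => S (S (S (S m))) end)).
    by move=> S e' [|[|n]].
Qed.

End Elementary.

(** ** Critical points *)

Section CriticalPoint.
Variables (V : set_structure) (hV : ZFC V) (M : V -> Prop) (j : V -> inner M).
Variable k : V.
Hypotheses (tM : transitive_class M) (ej : elementary j).
Hypotheses (crit : critical_point j k) (kjk : k in_ proj1_sig (j k)).

Lemma inner_inj (x y : inner M) : proj1_sig x = proj1_sig y -> x = y.
Proof.
case: x => x hx; case: y => y hy /= e; subst y.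
by rewrite (proof_irrelevance _ hx hy).
Qed.

(** [k] is in [M], being an element of [j k]. *)
Definition crit_in_inner : inner M := exist _ k (tM (proj2_sig (j k)) kjk).

(** Inner models are transitive, so elements of their elements belong to them. *)
Lemma inner_mem (x : inner M) (z : V) :
  z in_ proj1_sig x -> exists2 z' : inner M, proj1_sig z' = z & z' in_ x.
Proof. by move=> zx; exists (exist _ z (tM (proj2_sig x) zx)). Qed.

Lemma mem_j (x y : V) : x in_ y <-> j x in_ j y.
Proof.
by apply: (elementary_transfer ej (P := fun S x y _ => x in_ y)) x; rewrite /first_order; express.
Qed.

(** These sets play the part of the sets of rank below the critical point: they are
    too small for [k] to inject into them. *)
Definition fixed (X : V) : Prop :=
  proj1_sig (j X) = X /\ forall x, x in_ X -> proj1_sig (j x) = x.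

Lemma fixed_mem_crit (m : V) : m in_ k -> fixed m.
Proof.
case: crit => ok [_ hk] mk; split; first exact: hk.
by move=> x xm; apply: hk; exact: ordinal_trans ok xm mk.
Qed.

Lemma fixed_empty (o : V) : is_empty o -> fixed o.
Proof.
move=> ho; split; last by move=> x /ho.
apply: (set_ext hV) => z; split=> [/inner_mem [z' _ zo]|/ho //].
have : is_empty (j o); last by move=> /(_ _ zo).
apply/(elementary_transfer ej (P := fun S x _ _ => is_empty x) _ o o o) => //.
by rewrite /first_order; express.
Qed.

(** A subset [A] of [X] is [j A], since [x] is in [A] iff [x = j x] is in [j A]; in
    particular [M] has all subsets of [X]. *)
Lemma fixed_powerset (X P : V) : is_powerset P X -> fixed X -> fixed P.
Proof.
move=> hP [jX jx].
have jA A : A in_ P -> proj1_sig (j A) = A.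
  move=> /hP AX; apply: (set_ext hV) => z; split=> [zA|zA].
    have zX : z in_ X.
      have : subset (j A) (j X).
        apply/(elementary_transfer ej (P := fun S x y _ => subset x y) _ A X X) => //.
        by rewrite /first_order; express.
      have [z' e zA'] := inner_mem zA; move=> /(_ z' zA') /=; by rewrite jX e.
    by apply/mem_j; rewrite /= jx.
  have := proj1 (mem_j z A) zA; by rewrite /= jx //; exact: AX.
split=> //; have hjP : is_powerset (j P) (j X).
  apply/(elementary_transfer ej (P := fun S x y _ => is_powerset x y) _ P X X) => //.
  by rewrite /first_order; express.
apply: (set_ext hV) => z; split=> hz.
  have [z' e /hjP zX] := inner_mem hz; subst z; apply/hP => w wz.
  have [w' e wz'] := inner_mem wz; have := zX w' wz'; by rewrite /= jX e.
by have := proj1 (mem_j z P) hz; rewrite /= jA.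
Qed.

(** The injection [j f] takes at [k] a value [x = j x]; by elementarity [x] is
    also a value of [f] at some [b] in [k], so that [j f] takes it at [j b = b]. *)
Lemma not_injects_fixed (X : V) : fixed X -> ~ injects k X.
Proof.
move=> [jX jx] [f hf].
have [[jf jfX] jfi] : injection (j f) (j k) (j X).
  apply/(elementary_transfer ej (P := fun S x y z => injection x y z) _ f k X) => //.
  by rewrite /first_order; express.
case: (jf) => _ /(_ crit_in_inner kjk) [x' [kx' _]].
have x'X := jfX _ _ kx'; rewrite /= jX in x'X.
have ex : j (proj1_sig x') = x' by apply: inner_inj; exact: jx.
have [b bk bx] : exists2 b, b in_ k & maps f b (proj1_sig x').
  apply/(elementary_transfer ej (P := fun S x y z => exists2 b, b in_ y & maps x b z)
    _ f k (proj1_sig x')).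
    by rewrite /first_order; express.
  by exists crit_in_inner => //; rewrite ex.
have : maps (j f) (j b) x'.
  rewrite -ex.
  apply/(elementary_transfer ej (P := fun S x y z => maps x y z) _ f b (proj1_sig x')) => //.
  by rewrite /first_order; express.
move=> /jfi /(_ kx') /(f_equal (@proj1_sig _ _)) /=.
case: crit => _ [_ hk]; rewrite (hk b bk) => e; subst b; exact: (mem_irrefl hV bk).
Qed.

Lemma fixed_ordinal_mem_crit (x : V) : ordinal x -> fixed x -> x in_ k.
Proof.
move=> ox fx; case: crit => ok _.
case: (ordinal_mem_or_subset hV ox ok) => // kx.
case: (not_injects_fixed fx); exact: (subset_injects hV kx).
Qed.

(** The ordinal 2, as the double power set of the empty set, is below the critical
    point. It indexes the intersections of two sets of the measure. *)
Lemma ex_two_mem_crit :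
  exists t u v, t in_ k /\ u <> v /\ forall w, w in_ t <-> w = u \/ w = v.
Proof.
have [o ho] := ex_empty hV k; have [P hP] := ex_powerset hV o.
have [t ht] := ex_powerset hV P.
have oP z : z in_ P <-> z = o.
  rewrite hP; split=> [h|-> //]; apply: (set_ext hV) => w.
  by split=> [/h|/ho].
have et w : w in_ t <-> w = o \/ w = P.
  rewrite ht; split=> [wP|[->|->] //]; last by move=> z /ho.
  have [ow|ow] := classic (o in_ w); [right|left]; apply: (set_ext hV) => z.
    by split=> [/wP //|/oP ->].
  by split=> [zw|/ho //]; case: ow; move: (zw) => /wP /oP e; subst o.
exists t, o, P; split; last split=> //.
  apply: fixed_ordinal_mem_crit.
    split=> y /et [->|->] z; try by move/ho.
      by move=> /oP ->; apply/et; left.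
    by move=> /oP -> w /ho.
  by apply: (fixed_powerset ht); apply: (fixed_powerset hP); exact: fixed_empty.
by move=> e; apply: (ho o); rewrite {2}e; apply/oP.
Qed.

(** ** The square of a critical point *)

(** Both coordinates are at most [m]; for ordinals, inclusion is the weak order. *)
Definition below (p m : V) : Prop :=
  exists x y, is_pair p x y /\ subset x m /\ subset y m.

(** Enumerating the square so that the larger coordinate never decreases, the
    pairs that precede a given one lie in a triple power set of an element of
    [k]; the enumeration has therefore length at most [k]. *)
Lemma square_injects (X : V) :
  (forall p, p in_ X <-> exists x y, x in_ k /\ y in_ k /\ is_pair p x y) ->
  injects X k.
Proof.
move=> hX; case: (crit) => ok _.
have [||a [g [oa [hg gR]]]] := ex_enumeration hV (fun Y p =>
  exists2 m, m in_ k /\ below p m & forall n q, n in_ m -> q in_ Y -> ~ below q n)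
  X.
{ by express. }
{ move=> Y YX Y0.
  have [|m [mk [[p pY pm] hm]]] := min_element hV (fun m => exists2 p, p in_ Y & below p m) k
    ltac:(express).
    have [p pY] : exists p, p in_ Y by apply: NNPP => h; apply: Y0 => p pY; apply: h; exists p.
    have [x [y [xk [yk xy]]]] := proj1 (hX p) (YX p pY).
    have [ox oy] := (ordinal_mem ok xk, ordinal_mem ok yk).
    case: (ordinal_mem_or_subset hV ox oy) => [xy'|yx].
      exists y => //; exists p => //; exists x, y; do 2!split=> //.
      by case: oy => ty _; exact: ty.
    by exists x => //; exists p => //; exists x, y; do 2!split=> //.
  exists p => //; exists m => // n q nm qY qn.
  by apply: (hm n (ordinal_trans ok nm mk) nm); exists q. }
case: (ordinal_mem_or_subset hV ok oa) => [ka|ak]; last first.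
  apply: (injects_trans hV (equinumerous_injects_sym hV (ex_intro _ g hg))).
  exact: (subset_injects hV ak).
exfalso; case: hg => -[gf gX] gi.
case: (gf) => _ /(_ k ka) [p [kp _]].
have [_ _ [m [mk pm] _]] := gR _ _ kp.
have [P1 h1] := ex_powerset hV m; have [P2 h2] := ex_powerset hV P1.
have [P3 h3] := ex_powerset hV P2.
(* Pairs of subsets of [m] belong to the triple power set of [m]. *)
have f3 : fixed P3.
  apply: (fixed_powerset h3); apply: (fixed_powerset h2); apply: (fixed_powerset h1).
  exact: fixed_mem_crit.
apply: (not_injects_fixed f3).
have ginj x x' y : maps g x y -> maps g x' y -> x = x'.
  move=> xy x'y; have [w [_ hw]] := gi y (gX _ _ xy).
  by rewrite -(hw x xy) (hw x' x'y).
apply: (ex_injection hV (fun b q => maps g b q)); first by express.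
  move=> b bk; case: (gf) => _ /(_ b (ordinal_trans oa bk ka)) [q [bq uq]].
  exists q; split; last by move=> q' [_ /uq].
  split=> //; have [Y hY [n [nk qn] hn]] := gR _ _ bq.
  (* [p] was still available when [q] was picked, and [q] minimizes [n]. *)
  have nm : subset n m.
    case: (ordinal_mem_or_subset hV (ordinal_mem ok mk) (ordinal_mem ok nk)) => // mn.
    case: (hn m p mn) => //; apply/hY; split; first exact: gX kp.
    move=> c cb cp; have e := ginj _ _ _ cp kp; subst c.
    by case: (mem_asym hV bk).
  case: qn => x [y [xy [xn yn]]]; apply/h3 => w wq; apply/h2.
  by apply: (is_pair_subset_powerset xy _ _ wq); apply/h1 => z hz; apply: nm; [exact: xn|exact: yn].
by move=> x x' y _ _ _; exact: ginj.
Qed.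

End CriticalPoint.

(** * Normal fine measures *)

(** Pairs are absolute between [V] and a transitive inner model. *)
Lemma maps_inner (V : set_structure) (M : V -> Prop) (f x y : inner M) :
  transitive_class M ->
  maps f x y <-> maps (proj1_sig f) (proj1_sig x) (proj1_sig y).
Proof.
move=> tM.
have up (u a b : inner M) :
    is_upair u a b <-> is_upair (proj1_sig u) (proj1_sig a) (proj1_sig b).
  split=> h.
    move=> z; split.
      by move=> /inner_mem - /(_ tM) [z' <- /h [->|->]]; [left|right].
    by case=> ->; [apply: (proj2 (h a)); left|apply: (proj2 (h b)); right].
  move=> z; rewrite /= (h (proj1_sig z)).
  by split=> -[e|e]; [left; apply: inner_inj|right; apply: inner_inj
    |left; rewrite e|right; rewrite e].
split.
  move=> [p [a [b [ha [hb hp]]]] pf]; exists (proj1_sig p) => //.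
  by exists (proj1_sig a), (proj1_sig b); rewrite -!up.
move=> [p [a [b [ha [hb hp]]]] pf].
have [p' ep pf'] := inner_mem tM pf; subst p.
have [|a' ea _] := inner_mem tM (x := p') (z := a); first by apply/hp; left.
have [|b' eb _] := inner_mem tM (x := p') (z := b); first by apply/hp; right.
by subst a b; exists p' => //; exists a', b'; rewrite !up.
Qed.

Lemma ordinal_inner (V : set_structure) (M : V -> Prop) (x : inner M) :
  transitive_class M -> ordinal x -> ordinal (proj1_sig x).
Proof.
move=> tM [tx ox]; split.
  move=> y yx z zy; have [y' ey yx'] := inner_mem tM yx; subst y.
  by have [z' ez zy'] := inner_mem tM zy; subst z; exact: tx zy'.
move=> y yx z zy w wz; have [y' ey yx'] := inner_mem tM yx; subst y.
have [z' ez zy'] := inner_mem tM zy; subst z.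
by have [w' ew wz'] := inner_mem tM wz; subst w; exact: (ox y' yx' z' zy' w' wz').
Qed.

(** The injection of the power sets takes direct images. *)
Lemma powerset_injects (V : set_structure) (hV : ZFC V) (X Y P Q : V) :
  is_powerset P X -> is_powerset Q Y -> injects X Y -> injects P Q.
Proof.
move=> hP hQ [e [[ef eY] ei]].
apply: (ex_injection hV
  (fun A B => forall z, z in_ B <-> exists2 x, x in_ A & maps e x z)).
- by express.
- move=> A /hP AX.
  have [|B hB] := comprehension hV (fun z => exists2 x, x in_ A & maps e x z) Y.
    by express.
  have hB' z : z in_ B <-> exists2 x, x in_ A & maps e x z.
    by rewrite hB; split=> [[]//|h]; split=> //; case: h => x _; exact: eY.
  exists B; split; first by split=> //; apply/hQ => z /hB [].
  by move=> B' [_ h]; apply: (set_ext hV) => z; rewrite hB' h.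
- have sub A A' B : A in_ P -> (forall z, z in_ B <-> exists2 x, x in_ A & maps e x z) ->
      (forall z, z in_ B <-> exists2 x, x in_ A' & maps e x z) -> subset A A'.
    move=> /hP AX h h' x xA; case: (ef) => _ /(_ x (AX _ xA)) [z [xz _]].
    have /h' [x' x'A' x'z] : z in_ B by apply/h; exists x.
    by rewrite (ei _ _ _ xz x'z).
  move=> A A' B AP A'P _ h h'; apply: (set_ext hV) => z.
  by split; [exact: (sub A A' B)|exact: (sub A' A B)].
Qed.

(** The hypotheses unfold [normal_fine_measure U k k] and [generated_by j U k k],
    for one and the same set [P = P_k(k)]. *)
Section Measure.
Variables (V : set_structure) (hV : ZFC V) (M : V -> Prop) (j : V -> inner M).
Variables k U : V.
Hypotheses (dj : definable_map j) (tM : transitive_class M) (ej : elementary j).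
Hypotheses (crit : critical_point j k) (kjk : k in_ proj1_sig (j k)).

Variables (P : V) (cls : V -> inner M).
Hypothesis hP : is_Pk P k k.
Hypothesis PU : P in_ U.
Hypothesis U_mono : forall X Y, X in_ U -> subset X Y -> subset Y P -> Y in_ U.
Hypothesis U_ultra :
  forall X, subset X P -> X in_ U \/ large U P (fun x => ~ x in_ X).
Hypothesis U_complete : forall g f, g in_ k -> function f g U ->
  large U P (fun x => forall i X, maps f i X -> x in_ X).
Hypothesis U_fine : forall i, i in_ k -> large U P (fun x => i in_ x).
Hypothesis U_normal : forall f, function f k U ->
  large U P (fun x => forall i X, i in_ x -> maps f i X -> x in_ X).

Hypothesis cls_mem : forall f g, function_on f P -> function_on g P ->
  (cls f in_ cls g <->
   large U P (fun x => exists y z, maps f x y /\ maps g x z /\ y in_ z)).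
Hypothesis cls_eq : forall f g, function_on f P -> function_on g P ->
  (cls f = cls g <-> large U P (fun x => exists y, maps f x y /\ maps g x y)).
Hypothesis cls_onto : forall y : inner M, exists2 f, function_on f P & cls f = y.
Hypothesis cls_const : forall a c, function_on c P ->
  (forall x, x in_ P -> maps c x a) -> cls c = j a.

Lemma large_mono (Q Q' : V -> Prop) :
  class Q' -> (forall x, x in_ P -> Q x -> Q' x) -> large U P Q -> large U P Q'.
Proof.
move=> hQ' QQ' [X XU hX]; have [Y hY] := comprehension hV Q' P hQ'.
exists Y => //; apply: U_mono XU _ _ => x; last by move/hY => [].
by move=> /hX [xP Qx]; apply/hY; split=> //; exact: QQ'.
Qed.

Lemma large_all (Q : V -> Prop) : (forall x, x in_ P -> Q x) -> large U P Q.
Proof. by move=> h; exists P => // x; split=> [xP|[]//]; split=> //; exact: h. Qed.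

(** Completeness, applied to a sequence of length 2. *)
Lemma large_and (Q Q' : V -> Prop) :
  large U P Q -> large U P Q' -> large U P (fun x => Q x /\ Q' x).
Proof.
move=> [X XU hX] [Y YU hY].
have [t [u [v [tk [uv ht]]]]] := ex_two_mem_crit hV tM ej crit kjk.
have [||f [ff fE]] := ex_function hV (fun i Z => i = u /\ Z = X \/ i = v /\ Z = Y) t U.
{ by express. }
{ move=> i /ht [->|->]; [exists X|exists Y]; split.
  - by split=> //; left.
  - by move=> Z [_ [[_ ->]|[e _]]].
  - by split=> //; right.
  - by move=> Z [_ [[e _]|[_ ->]]] //; case: uv. }
have [Z ZU hZ] := U_complete tk ff; exists Z => // x.
have mX : maps f u X by apply/fE; split; [apply/ht|]; auto.
have mY : maps f v Y by apply/fE; split; [apply/ht|]; auto.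
rewrite hZ; split=> [[xP h]|[xP [Qx Q'x]]]; split=> //.
  by split; [case/hX: (h _ _ mX)|case/hY: (h _ _ mY)].
by move=> i W /fE [_ [_ [[_ ->]|[_ ->]]]]; [apply/hX|apply/hY].
Qed.

Lemma large_or (Q Q' : V -> Prop) :
  class Q -> class Q' -> large U P (fun x => Q x \/ Q' x) ->
  large U P Q \/ large U P Q'.
Proof.
move=> hQ hQ' h; have [X hX] := comprehension hV Q P hQ.
have [|XU|nX] := U_ultra (X := X); first by move=> x /hX [].
  by left; exists X.
right; apply: large_mono hQ' _ (large_and h nX) => x xP [[Qx|//] nx].
by case: nx; apply/hX.
Qed.

(** A set is transitive iff it lies in the diagonal intersection of the sets of
    all [x] that include [i]. Each of these is in the measure by fineness and
    completeness, as it is an intersection of fewer than [k] sets. *)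
Lemma large_transitive_set : large U P (fun x => transitive_set x).
Proof.
case: (crit) => ok _.
have [||f [ff fE]] := ex_function hV
  (fun i Z => forall x, x in_ Z <-> x in_ P /\ subset i x) k U.
{ by express. }
{ move=> i ik.
  have [||h [hh hE]] := ex_function hV
    (fun e Z => forall x, x in_ Z <-> x in_ P /\ e in_ x) i U.
  { by express. }
  { move=> e ei; have [Z ZU hZ] := U_fine (ordinal_trans ok ei ik).
    exists Z; split=> // Z' [_ hZ']; apply: (set_ext hV) => x.
    by rewrite hZ hZ'. }
  have [Z ZU hZ] := U_complete ik hh; exists Z.
  have hZ' x : x in_ Z <-> x in_ P /\ subset i x.
    rewrite hZ; split=> -[xP hx]; split=> //.
      move=> e ei; case: (hh) => -[_ /(_ e ei) [W [eW _]]] _.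
      by have /hE [_ [_ hW]] := eW; case/hW: (hx _ _ eW).
    by move=> e W /hE [ei [_ hW]]; apply/hW; split=> //; exact: hx.
  split=> // Z2 [_ hZ2]; apply: (set_ext hV) => x.
  by rewrite hZ' hZ2. }
apply: large_mono (U_normal ff); first by express.
move=> x xP h i ix.
have ik : i in_ k by case/hP: xP => xk _; exact: xk.
case: (ff) => -[_ /(_ i ik) [Z [iZ _]]] _.
by have /fE [_ [_ hZ]] := iZ; case/hZ: (h _ _ ix iZ).
Qed.

(** It is an ordinal included in [k], and it is not [k] because its size is that of
    an element of [k], into which [k] does not inject. *)
Lemma transitive_mem_crit (x : V) : x in_ P -> transitive_set x -> x in_ k.
Proof.
move=> /hP [xk [g gk xg]] tx; case: (crit) => ok _.
have ox : ordinal x by split=> // y /xk; case: ok => _; apply.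
case: (ordinal_mem_or_subset hV ox ok) => // kx.
case: (not_injects_fixed hV tM ej crit kjk (fixed_mem_crit crit gk)).
apply: (injects_trans hV (subset_injects hV kx)).
exact: (equinumerous_injects xg).
Qed.

(** ** The ultrapower *)

(** The instance of the theorem of Los that the coding of ordered pairs needs. *)
Lemma cls_upair (f g u : V) :
  function_on f P -> function_on g P -> function_on u P ->
  (forall x a b c, maps f x a -> maps g x b -> maps u x c -> is_upair c a b) ->
  is_upair (cls u) (cls f) (cls g).
Proof.
move=> ff fg fu hu z; have [h fh <-] := cls_onto z.
rewrite cls_mem // !cls_eq //; split.
  move=> hl; apply: large_or; [by express|by express|].
  apply: large_mono hl; first by express.
  move=> x xP [y [w [xy [xw yw]]]].
  case: (ff) => _ /(_ x xP) [a [xa _]]; case: (fg) => _ /(_ x xP) [b [xb _]].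
  by move: yw => /(hu _ _ _ _ xa xb xw) [e|e]; [left|right]; exists y; split=> //; rewrite e.
have tot x : x in_ P -> exists a b c, maps f x a /\ maps g x b /\ maps u x c.
  move=> xP; case: (ff) => _ /(_ x xP) [a [xa _]].
  case: (fg) => _ /(_ x xP) [b [xb _]]; case: (fu) => _ /(_ x xP) [c [xc _]].
  by exists a, b, c.
case; apply: large_mono; try by express.
  move=> x xP [y [xy xfy]]; have [a [b [c [xa [xb xc]]]]] := tot x xP.
  by exists y, c; do 2!split=> //; apply/(hu _ _ _ _ xfy xb xc); left.
move=> x xP [y [xy xgy]]; have [a [b [c [xa [xb xc]]]]] := tot x xP.
by exists y, c; do 2!split=> //; apply/(hu _ _ _ _ xa xgy xc); right.
Qed.

Lemma ex_const (a : V) : exists2 c, function_on c P & forall x y, maps c x y <-> x in_ P /\ y = a.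
Proof.
have [||c [fc cE]] := ex_function_on hV (fun _ y => y = a) P; last by exists c.
  by express.
by move=> x _; exists a; split.
Qed.

(** The class [s] of the identity generates the ultrapower: [(x, f x)] is in [f]
    for every [x], so the class of [x |-> (x, f x)], which is the pair of [s] and
    [cls f], is in the class of the constant [f], which is [j f]. In contrast to
    [cls], the map [f |-> j(f)(s)] is definable in [V]. *)
Lemma ex_seed : exists s : inner M, forall f, function_on f P -> maps (j f) s (cls f).
Proof.
have [||d [fd dE]] := ex_function_on hV (fun x y => y = x) P.
{ by express. }
{ by move=> x _; exists x; split. }
exists (cls d) => f ff.
have [c fc cE] := ex_const f.
have [||a [fa aE]] := ex_function_on hV (fun x y => is_upair y x x) P.
{ by express. }
{ move=> x _; have [y hy] := ex_upair hV x x; exists y; split=> // y' hy'.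
  exact: (is_upair_unique hV hy hy'). }
have [||b [fb bE]] := ex_function_on hV (fun x y => exists2 z, maps f x z & is_upair y x z) P.
{ by express. }
{ move=> x xP; case: (ff) => _ /(_ x xP) [z [xz uz]].
  have [y hy] := ex_upair hV x z; exists y; split; first by exists z.
  by move=> y' [z' /uz <-]; exact: (is_upair_unique hV hy). }
have [||p [fp pE]] := ex_function_on hV (fun x y => exists2 z, maps f x z & is_pair y x z) P.
{ by express. }
{ move=> x xP; case: (ff) => _ /(_ x xP) [z [xz uz]].
  have [y hy] := ex_pair hV x z; exists y; split; first by exists z.
  by move=> y' [z' /uz <-]; exact: (is_pair_unique hV hy). }
exists (cls p).
{ exists (cls a), (cls b); split; last split.
  - by apply: cls_upair => // x y z w /dE [_ ->] /dE [_ ->] /aE [].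
  - apply: cls_upair => // x y z w /dE [_ ->] xz /bE [_ [z' xz']].
    by rewrite (function_on_val hV ff xz xz').
  - apply: cls_upair => // x y z w /aE [_ hy] /bE [_ [z' xz' hz]] /pE [_ [z'' xz'' hw]].
    rewrite (function_on_val hV ff xz'' xz') in hw; case: hw => a' [b' [ha' [hb' hw]]].
    by rewrite (is_upair_unique hV hy ha') (is_upair_unique hV hz hb'). }
have <- : cls c = j f by apply: cls_const => // x xP; apply/cE.
apply/cls_mem => //; apply: large_all => x xP.
case: (fp) => _ /(_ x xP) [q [xq _]]; exists q, f; split=> //.
split; first by apply/cE.
by have /pE [_ [z xz hq]] := xq; apply/(maps_pair hV f hq).
Qed.

(** A function on [P_k(k)] with values in [k] on a large set is determined up
    to a null set by the part of its graph that lies in [k * k], since almost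
    every element of [P_k(k)] is an ordinal below [k]. *)
Lemma j_crit_injects_powerset (Q : V) :
  is_powerset Q k -> injects (proj1_sig (j k)) Q.
Proof.
move=> hQ; have [X hX] := ex_product hV k k; have [PX hPX] := ex_powerset hV X.
apply: (injects_trans hV (B := PX)); last first.
  apply: (powerset_injects hV hPX hQ).
  exact: (square_injects hV tM ej crit kjk hX).
have [s hs] := ex_seed.
have hj : relation (fun f F => proj1_sig (j f) = F).
  case: dj => p [e he].
  exists p, (fun n => match n with O => inl 0 | S O => inl 1 | S (S n) => inr (fun _ => e n) end).
  by move=> [] e'; rewrite he; apply: sat_ext => -[|[|n]].
(* [A] is the part inside [k * k] of the graph of some [f] that represents [y]. *)
pose R y A := exists f F, function_on f P /\ proj1_sig (j f) = F /\
  maps F (proj1_sig s) y /\ forall p, p in_ A <-> p in_ X /\ p in_ f.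
have [||C [hC CR]] := ex_choice_function hV R (proj1_sig (j k)) PX.
{ rewrite /R.
  refine (expressible_ex (expressible_ex (expressible_and _ (expressible_and _ _)))).
  - by express.
  - exact: (expressible_relation (R := fun _ f F => proj1_sig (j f) = F) hj
      (term_var _ _) (term_var _ _)).
  - by express. }
{ move=> y yk; have [y' ey _] := inner_mem tM yk; subst y.
  have [f ff <-] := cls_onto y'.
  have [|A hA] := comprehension hV (fun p => p in_ f) X; first by express.
  exists A; first by apply/hPX => p /hA [].
  exists f, (proj1_sig (j f)); do 3!split=> //.
  by apply/maps_inner => //; exact: hs. }
exists C; split=> // y y' A yA y'A.
have key z : maps C z A -> exists f, function_on f P /\ proj1_sig (cls f) = z /\
    cls f in_ j k /\ forall p, p in_ A <-> p in_ X /\ p in_ f.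
  move=> zA; have zk : z in_ proj1_sig (j k).
    by case: (hC) => fC _; exact: (function_on_dom hV fC zA).
  have [f [F [ff [eF [hF hA]]]]] := CR _ _ zA; exists f; split=> //; subst F.
  have [z' ez zk'] := inner_mem tM zk; subst z.
  have e : cls f = z'.
    have fjf : function_on (j f) (j P).
      apply/(elementary_transfer ej (P := fun S x y _ => function_on x y) _ f P P) => //.
      by rewrite /first_order; express.
    apply: (function_on_val (elementary_ZFC ej hV) fjf (hs f ff)).
    by apply/maps_inner.
  by rewrite e.
have [f [ff [ef [fk fA]]]] := key y yA; have [g [fg [eg [gk gA]]]] := key y' y'A.
suff e : cls f = cls g by rewrite -ef -eg e.
have [c fc cE] := ex_const k.
have ec : cls c = j k by apply: cls_const => // x xP; apply/cE.
rewrite -ec in fk; apply/cls_eq => //.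
apply: large_mono (large_and large_transitive_set (proj1 (cls_mem ff fc) fk)).
  by express.
move=> x xP [tx [v [w [xv [/cE [_ ->] vk]]]]]; exists v; split=> //.
have [p hp] := ex_pair hV x v; exists p => //.
have /gA [] // : p in_ A.
apply/fA; split; last by apply/(maps_pair hV f hp).
by apply/hX; exists x, v; split=> //; exact: transitive_mem_crit.
Qed.

End Measure.

(** * Hypercompactness *)

(** The induction hypothesis has to reach through the existential quantifiers over
    the inner model and the embedding, which are nested in the inductive type. *)
Lemma excessively_hypercompact_induction
    (Q : forall V : set_structure, V -> V -> Prop) :
  (forall (V : set_structure) (k a : V), is_empty a -> Q V k a) ->
  (forall (V : set_structure) (k a : V), ordinal a -> cardinal k ->
    (forall d : V, cardinal d -> subset k d ->
       exists (M : V -> Prop) (j : V -> inner M),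
         witnesses_supercompactness j k d /\
         (exists U : V, normal_fine_measure U k d /\ generated_by j U k d) /\
         (forall b : V, b in_ a -> exists k' b' : inner M,
            proj1_sig k' = k /\ proj1_sig b' = b /\ Q (inner M) k' b')) ->
    Q V k a) ->
  forall (V : set_structure) (k a : V), excessively_hypercompact_at k a -> Q V k a.
Proof.
move=> h0 hpos; fix IH 4 => V k a [W l c c0 _|W l c oc _ cl hc].
  exact: h0.
apply: hpos => // d cd ld; case: (hc d cd ld) => M [j [wj [hU hb]]].
exists M, j; do 2!split=> //; move=> b bc; case: (hb b bc) => k' [b' [ek [eb h]]].
by exists k', b'; do 2!split=> //; apply: IH.
Qed.

(** The bound on the degree: [a] is less than the successor of [2 ^ k]. It is stated
    by injections so that it is also meaningful in the inner models, where the
    induction hypothesis applies. *)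
Lemma hypercompact_degree_injects (V : set_structure) (k a : V) :
  excessively_hypercompact_at k a -> ZFC V ->
  exists2 Q, is_powerset Q k & injects a Q.
Proof.
move=> h; elim/excessively_hypercompact_induction: V k a / h => V k a.
  move=> a0 hV; have [Q hQ] := ex_powerset hV k; exists Q => //.
  by apply: (subset_injects hV) => x /a0.
move=> oa ck step hV; have [|M [j [wj [[U [nU gU]] hb]]]] := step k ck; first by [].
case: wj => _ [tM [dj [ej [crit [kjk _]]]]].
have [Q hQ] := ex_powerset hV k; exists Q => //.
have hjk : injects (proj1_sig (j k)) Q.
  case: nU => P [hP [_ [PU [_ [Umono [Uultra [Ucompl [Ufine Unormal]]]]]]]].
  case: gU => P' [cls [hP' [cmem [ceq [conto cconst]]]]].
  have e : P' = P by apply: (set_ext hV) => x; rewrite hP hP'.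
  subst P'.
  exact: (j_crit_injects_powerset hV dj tM ej crit kjk hP PU Umono Uultra Ucompl
    Ufine Unormal cmem ceq conto cconst hQ).
have oj : ordinal (proj1_sig (j k)).
  apply: (ordinal_inner tM); case: (crit) => ok _.
  apply/(elementary_transfer ej (P := fun S x _ _ => ordinal x) _ k k k) => //.
  by rewrite /first_order; express.
case: (ordinal_mem_or_subset hV oj oa) => [ja|aj]; last first.
  exact: (injects_trans hV (subset_injects hV aj) hjk).
exfalso; have [k' [b' [ek [eb IH]]]] := hb _ ja.
have {}eb : b' = j k by exact: inner_inj.
have kk : k' in_ j k by rewrite /= ek.
subst b'; have [Q' hQ' jQ'] := IH (elementary_ZFC ej hV).
have : forall m, m in_ j k -> ~ exists2 Q, is_powerset Q m & injects (j k) Q.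
  apply/(elementary_transfer ej (P := fun S x _ _ =>
    forall m, m in_ x -> ~ exists2 Q, is_powerset Q m & injects x Q) _ k k k).
    by rewrite /first_order; express.
  move=> m mk [R hR kR]; apply: (not_injects_fixed hV tM ej crit kjk _ kR).
  exact: (fixed_powerset hV tM ej hR (fixed_mem_crit crit mk)).
by move=> /(_ k' kk); apply; exists Q'.
Qed.

Theorem theorem6p2 (V : set_structure) (hV : ZFC V) :
  (~ exists k : V, excessively_hypercompact k) /\
  (~ exists k c a : V,
       cardinal k /\ is_two_pow c k /\ is_card_succ a c /\
       excessively_hypercompact_at k a).
Proof.
split.
- move=> [k [_ hk]]; have [P hP] := ex_powerset hV k.
  have [PP hPP] := ex_powerset hV P.
  have [a oa aPP] := ex_equinumerous_ordinal hV PP.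
  have [P' hP' aP'] := hypercompact_degree_injects (hk a oa) hV.
  have e : P' = P by apply: (set_ext hV) => x; rewrite hP hP'.
  subst P'; apply: (cantor hV hPP).
  exact: (injects_trans hV (equinumerous_injects_sym hV aPP)).
- move=> [k [c [a [_ [[cc [P hP Pc]] [[ca [cina _]] hk]]]]]].
  have [P' hP' aP'] := hypercompact_degree_injects hk hV.
  have e : P' = P by apply: (set_ext hV) => x; rewrite hP hP'.
  subst P'; case: ca => [[ta _] /(_ c cina)]; apply.
  apply: (schroeder_bernstein hV (ta c cina)).
  exact: (injects_trans hV aP' (equinumerous_injects Pc)).
Qed.
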